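(* Let $l$ be any positive integer and let $P$ be an $l$-reflexive polygon with respect to a lattice $N\cong\mathbb{Z}^2$. Then $P$ has at most nine boundary lattice points, i.e. $|\partial P\cap N|\le 9$, and at most six vertices.
   Context: Let $M=\mathrm{Hom}(N,\mathbb{Z})$. A polygon here is a 2-dimensional convex lattice polytope $P\subset N\otimes_{\mathbb{Z}}\mathbb{Q}$, i.e. its vertices lie in $N$; $\partial P$ is its boundary. A nonzero lattice point $x$ is primitive if the segment from $\mathbf{0}$ to $x$ contains no lattice points other than its endpoints. If $P$ has the origin in its interior and $F$ is a facet (edge) of $P$, the primitive outer normal of $F$ is the unique primitive $u_F\in M$ such that $F=\{x\in P\mid\langle u_F,x\rangle=l_F\}$ for some positive integer $l_F$, called the local index of $F$. $P$ is $l$-reflexive if it contains the origin in its interior, all its vertices are primitive, and $l_F=l$ for every facet $F$. *)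

(* Defs.v *)
From HB Require Import structures.
From mathcomp Require Import all_boot all_order all_algebra.
From mathcomp Require Import all_classical all_reals all_analysis.

Set Implicit Arguments.
Unset Strict Implicit.
Unset Printing Implicit Defensive.

Import Order.TTheory GRing.Theory Num.Theory.
Import numFieldNormedType.Exports.

Local Open Scope classical_set_scope.
Local Open Scope ring_scope.

(* The ambient plane [N (x) Q] is ['rV[K]_2] with [K := rat].  The definitions
   are stated over a [realFieldType] because [rat] only gets its topology from
   its [numFieldType] structure; no completeness of [K] is used. *)

(* [N] is the set of integer combinations of a basis of the plane, i.e. a
   lattice isomorphic to Z^2 with [N (x) K] the whole plane. *)
Definition lattice (K : realFieldType) (N : set 'rV[K]_2) : Prop :=
  exists2 B : 'M[K]_2, B \in unitmx &
    N = [set map_mx intr z *m B | z in [set: 'rV[int]_2]].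

(* [Hom(N, Z)]: a homomorphism N -> Z is identified with its unique linear
   extension to the plane. *)
Definition dual_lattice (K : realFieldType) (N : set 'rV[K]_2) :
    set 'Hom('rV[K]_2, K^o) :=
  [set u | forall x, N x -> exists z : int, u x = z%:~R].

Definition segment0 (K : realFieldType) (V : lmodType K) (x : V) : set V :=
  [set t *: x | t in `[0, 1]].

(* [L] is [N] for the vertices and [Hom(N, Z)] for the normals. *)
Definition primitive (K : realFieldType) (V : lmodType K)
    (L : set V) (x : V) : Prop :=
  [/\ L x, x != 0 & forall y, L y -> segment0 x y -> y = 0 \/ y = x].

Definition has_dim (K : realFieldType) (A : set 'rV[K]_2) (d : nat) : Prop :=
  A !=set0 /\
  exists U : {vspace 'rV[K]_2},
    [/\ \dim U = d,
        forall x y, A x -> A y -> x - y \in U &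
        forall W : {vspace 'rV[K]_2},
          (forall x y, A x -> A y -> x - y \in W) -> (U <= W)%VS].

Definition polytope (K : realFieldType) (P : set 'rV[K]_2) : Prop :=
  exists s : seq 'rV[K]_2, P = smallest (@convex_set K 'rV[K]_2) [set` s].

Definition face (K : realFieldType) (P F : set 'rV[K]_2) : Prop :=
  exists (u : 'Hom('rV[K]_2, K^o)) (c : K),
    (forall x, P x -> u x <= c :> K) /\ F = [set x | P x /\ u x = c].

Definition facet (K : realFieldType) (P F : set 'rV[K]_2) : Prop :=
  face P F /\ has_dim F 1.

Definition vertices (K : realFieldType) (P : set 'rV[K]_2) : set 'rV[K]_2 :=
  [set v | face P [set v]].

Definition boundary (K : realFieldType) (P : set 'rV[K]_2) : set 'rV[K]_2 :=
  closure P `\` P°.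

Definition polygon (K : realFieldType) (N P : set 'rV[K]_2) : Prop :=
  [/\ polytope P, has_dim P 2 & vertices P `<=` N].

Definition primitive_outer_normal (K : realFieldType) (N P F : set 'rV[K]_2)
    (u : 'Hom('rV[K]_2, K^o)) (k : nat) : Prop :=
  [/\ primitive (dual_lattice N) u, (0 < k)%N &
      F = [set x | P x /\ u x = k%:R]].

Definition local_index (K : realFieldType) (N P F : set 'rV[K]_2)
    (k : nat) : Prop :=
  exists u, primitive_outer_normal N P F u k.

Definition l_reflexive (K : realFieldType) (N : set 'rV[K]_2) (l : nat)
    (P : set 'rV[K]_2) : Prop :=
  [/\ P° 0,
      forall v, vertices P v -> primitive N v &
      forall F, facet P F -> local_index N P F l].

(* Main.v *)
(* Let [u] and [u'] be the normals of two facets meeting at a vertex [v], scaled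
   to be 1 on their facets. Since [v] is primitive, [u] and [u'] are integral at
   the same points of [N]; going around the polygon, all facet normals are
   integral on one and the same sublattice [L] of [N], namely where one of them
   is. So [P] is 1-reflexive for [L]: each facet lies on [u = 1] with [u]
   integral on [L], [0] is the only interior point of [L], and [L] contains the
   boundary points of [N].
   If the boundary points of [L] are pairwise incongruent modulo 3 there are at
   most 9 of them. Otherwise two congruent ones lie on an edge of lattice length
   at least 3, and an edge this long leaves room for few points in the rows
   parallel to it.
   For the vertices one argues modulo 2: no vertex is 0, and if each of the three
   nonzero classes has at most two vertices we are done. Three congruent vertices
   force two of the edges to have even length and share a vertex [x], and then
   [P] is a triangle or its vertices lie in an explicit six-element list. *)

Require Import Defs.
From HB Require Import structures.
From mathcomp Require Import all_boot all_order all_algebra.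
From mathcomp Require Import ring lra zify.
From mathcomp Require Import all_classical all_reals all_analysis.

Set Implicit Arguments.
Unset Strict Implicit.
Unset Printing Implicit Defensive.

Import Order.TTheory GRing.Theory Num.Theory.
Import numFieldNormedType.Exports.

Local Open Scope ring_scope.
Local Open Scope classical_set_scope.
Local Open Scope card_scope.

(** * Functionals as row vectors, and counting by lists and injections *)

Definition dot (K : realFieldType) (g x : 'rV[K]_2) : K :=
  g 0 0 * x 0 0 + g 0 1 * x 0 1.

Lemma dotD (K : realFieldType) (g x y : 'rV[K]_2) : dot g (x + y) = dot g x + dot g y.
Proof. rewrite /dot !mxE; ring. Qed.

Lemma dotZ (K : realFieldType) (g x : 'rV[K]_2) a : dot g (a *: x) = a * dot g x.
Proof. rewrite /dot !mxE; ring. Qed.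
Lemma card_le_seq (T : eqType) (A : set T) (s : seq T) :
  (forall x, A x -> x \in s) -> (A #<= `I_(size s))%card.
Proof.
move=> As; case: s As => [|x0 s] As.
  rewrite (_ : A = set0) ?card_ge0//.
  by apply/seteqP; split => [x /As|x []].
apply: card_le_trans (card_image_le (nth x0 (x0 :: s)) _).
apply: subset_card_le => x /As /(nthP x0)[i lti <-] /=; by exists i.
Qed.

Lemma card_le_inj (T : Type) (A : set T) (f : T -> nat) (n : nat) :
  (forall x, A x -> (f x < n)%N) ->
  (forall x y, A x -> A y -> f x = f y -> x = y) -> (A #<= `I_n)%card.
Proof.
move=> fn finj; have /card_eqPle[+ _] : (A #= f @` A)%card.
  rewrite card_eq_sym; apply: inj_card_eq => x y; rewrite !inE; exact: finj.
by move=> /(card_le_trans) -> //; apply: subset_card_le => _ [x /fn ? <-].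
Qed.
Lemma z1 (K: realFieldType) (z : int) : (z%:~R <= 1 :> K) -> z != 1 -> z%:~R <= 0 :> K.
Proof. rewrite -[1]/(1%:~R) ler_int lerz0. lia. Qed.

(** * Lattice points of a polygon with facets at height one *)

(** [U] stands for the facet normals, scaled to be 1 on their facets, so this is the polygon as an
    intersection of half-planes. *)
Definition polar (K : realFieldType) (U : set 'rV[K]_2) : set 'rV[K]_2 :=
  [set x | forall u, U u -> dot u x <= 1].

Lemma polar_conv (K : realFieldType) (U : set 'rV[K]_2) x y (a b : K) :
  polar U x -> polar U y -> 0 <= a -> 0 <= b -> a + b <= 1 ->
  polar U (a *: x + b *: y).
Proof.
move=> Px Py a0 b0 ab u Uu; rewrite dotD !dotZ.
by have := Px u Uu; have := Py u Uu; nra.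
Qed.

Lemma int_le1_neq1 (a : int) : a <= 1 -> a != 1 -> a <= 0.
Proof. lia. Qed.

Lemma int_in_N1_0 (a : int) : a <= 0 -> - a <= 1 -> a = 0 \/ a = -1.
Proof. lia. Qed.

(** An axiomatic form of a 1-reflexive polygon for the lattice [L]: [U_pos] bounds it in every
    direction, and [U_neg] puts one of its lattice points beyond the origin as seen from each
    facet. *)
Section ReflexivePolygon.
Variables (K : realFieldType) (L U : set 'rV[K]_2).
Local Notation P := (polar U).
Hypothesis L_comb : forall (a b : int) x y, L x -> L y ->
  L (a%:~R *: x + b%:~R *: y).
Hypothesis U_int : forall u x, U u -> L x -> exists z : int, dot u x = z%:~R.
Hypothesis U_ker : forall u, U u -> exists e, [/\ L e, dot u e = 0 &
  forall x, L x -> dot u x = 0 -> exists b : int, x = b%:~R *: e].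
Hypothesis U_pos : forall x, x != 0 -> exists2 u, U u & 0 < dot u x.
Hypothesis U_one : forall u, U u -> exists2 v, L v & dot u v = 1.
Hypothesis U_neg : forall u, U u -> exists q, [/\ L q, P q & dot u q < 0].

Lemma dot_pos_ge1 u x : U u -> L x -> 0 < dot u x -> 1 <= dot u x.
Proof.
move=> Uu Lx; have [z ->] := U_int Uu Lx.
by rewrite -[1]/(1%:~R) ltr0z ler_int => ?; lia.
Qed.

(** A positive integer that is at most 1 equals 1; hence no nonzero lattice point is interior. *)
Lemma facet_of_lattice_point x : L x -> P x -> x != 0 ->
  exists2 u, U u & dot u x = 1.
Proof.
move=> Lx Px /U_pos[u Uu ux]; exists u => //.
by apply/eqP; rewrite eq_le Px//= dot_pos_ge1.
Qed.

Lemma lattice_scale_le1 x (t : K) : L x -> x != 0 -> P (t *: x) -> t <= 1.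
Proof.
move=> Lx /U_pos[u Uu ux] /(_ u Uu); rewrite dotZ => tux.
by have := dot_pos_ge1 Uu Lx ux; nra.
Qed.

(** A normal with value 1 at [z] averages two values at most 1 with positive weights, so both are
    1. *)
Lemma common_facet x y z (a b : K) : L z -> z != 0 -> P x -> P y ->
  0 < a -> 0 < b -> a + b = 1 -> z = a *: x + b *: y ->
  exists2 u, U u & dot u x = 1 /\ dot u y = 1.
Proof.
move=> Lz z0 Px Py a0 b0 ab zE.
have Pz : P z by rewrite zE; apply: polar_conv => //; lra.
have [u Uu uz] := facet_of_lattice_point Lz Pz z0; exists u => //.
move: uz; rewrite zE dotD !dotZ.
by have := Px u Uu; have := Py u Uu; split; nra.
Qed.

Lemma facet_frame u v : U u -> L v -> dot u v = 1 ->
  exists e, [/\ L e, dot u e = 0 &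
    forall x, L x -> exists a b : int, x = a%:~R *: v + b%:~R *: e].
Proof.
move=> Uu Lv uv; have [e [Le ue eP]] := U_ker Uu; exists e; split => // x Lx.
have [a ua] := U_int Uu Lx.
have [||b xE] := eP (1%:~R *: x + (- a)%:~R *: v).
- exact: L_comb.
- by rewrite dotD !dotZ ua uv rmorphN /=; ring.
exists a, b; rewrite -xE; apply/rowP => i; rewrite !mxE; ring.
Qed.

(** Coordinates in a frame, reduced modulo [m], encode the class of [x] in [L / m L] as a two-digit
    number in base [m]; the zero class gets code 0. *)
Lemma residue_classes u (m : nat) : U u -> (0 < m)%N ->
  exists rho : 'rV[K]_2 -> nat, forall x, L x ->
    [/\ (rho x < m * m)%N,
        rho x = 0%N -> exists2 z, L z & x = m%:R *: z &
        forall y, L y -> rho x = rho y -> exists2 z, L z & x - y = m%:R *: z].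
Proof.
move=> Uu m0; have [v Lv uv] := U_one Uu.
have [e [Le ue veP]] := facet_frame Uu Lv uv.
have /choice[c cP] : forall x, exists p : int * int,
    L x -> x = p.1%:~R *: v + p.2%:~R *: e.
  move=> x; have [/veP[a [b xE]]|nLx] := pselect (L x); last by exists (0, 0).
  by exists (a, b).
pose r (z : int) := absz (z %% m%:Z)%Z.
have rm z : (r z < m)%N by rewrite /r; have := @ltz_pmod z m; lia.
have rE z : z = (z %/ m%:Z)%Z * m%:Z + (r z)%:Z.
  by rewrite /r gez0_abs ?modz_ge0 -?divz_eq//; lia.
pose rho x : nat := (r (c x).1 * m + r (c x).2)%N.
exists rho => x Lx; rewrite /rho.
split.
- by have := rm (c x).1; have := rm (c x).2; nia.
- move=> r0; have r1 : r (c x).1 = 0%N by nia.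
  have r2 : r (c x).2 = 0%N by nia.
  have := rE (c x).1; have := rE (c x).2; rewrite r1 r2.
  set b := (_ %/ _)%Z; set a := (_ %/ _)%Z => E2 E1.
  exists (a%:~R *: v + b%:~R *: e); first exact: L_comb.
  rewrite {1}(cP _ Lx) E1 E2; apply/rowP => i; rewrite !mxE; ring.
- move=> y Ly rxy.
  have : r (c x).1 = r (c y).1 /\ r (c x).2 = r (c y).2.
    have := congr1 (modn^~ m) rxy; rewrite /rho /= !modnMDl !modn_small// => r2.
    split=> //; apply/eqP; rewrite -(eqn_pmul2r m0); apply/eqP.
    by move: rxy; rewrite /rho r2 => /addIn.
  move=> [r1 r2].
  have := rE (c x).1; have := rE (c x).2; rewrite r1 r2.
  have := rE (c y).1; have := rE (c y).2.
  move: (r (c y).1) (r (c y).2) => s1 s2.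
  set d1 := (_ %/ _)%Z; set d2 := (_ %/ _)%Z => F2 F1.
  set d3 := (_ %/ _)%Z; set d4 := (_ %/ _)%Z => E2 E1.
  exists ((d4 - d2)%:~R *: v + (d3 - d1)%:~R *: e); first exact: L_comb.
  rewrite {1}(cP _ Lx) {1}(cP _ Ly) E1 E2 F1 F2.
  apply/rowP => i; rewrite !mxE; ring.
Qed.

(* Joining [q] to the points [v] and [v + k e] of the edge cuts the line [K e],
   which the polygon meets only inside [[-e, e]]. *)
Lemma row_bound v e q (a b : int) (k : nat) : L e -> e != 0 -> P v ->
  P (v + k%:R *: e) -> P q -> q = a%:~R *: v + b%:~R *: e -> a <= 0 ->
  (a - 1 <= b) && (b <= 1 - a + a * k%:Z).
Proof.
move=> Le e0 Pv Pvk Pq qE a0.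
have a0' : a%:~R <= 0 :> K by rewrite lerz0.
have c0 : 0 < 1 - a%:~R :> K by rewrite subr_gt0 (le_lt_trans a0').
have cN0 : 1 - a%:~R != 0 :> K by rewrite gt_eqF.
have ci0 : 0 < (1 - a%:~R)^-1 :> K by rewrite invr_gt0.
have eN0 : - e != 0 by rewrite oppr_eq0.
have LN : L (- e).
  have := L_comb (-1) 0 Le Le; congr L.
  by apply/rowP => i; rewrite !mxE; ring.
(* With these weights on [q] and on an end of the edge the multiples of [v] cancel, and a multiple
   of [e] remains. *)
have sum1 : (1 - a%:~R)^-1 + - a%:~R * (1 - a%:~R)^-1 = 1 :> K by field.
have ac0 : 0 <= - a%:~R * (1 - a%:~R)^-1 :> K.
  by apply: mulr_ge0; rewrite ?oppr_ge0// ltW.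
apply/andP; split.
- have : - b%:~R / (1 - a%:~R) <= 1 :> K.
    apply: (lattice_scale_le1 LN eN0).
    have := polar_conv Pq Pv (ltW ci0) ac0; rewrite sum1 => /(_ (lexx _)).
    congr P; rewrite qE; apply/rowP => i; rewrite !mxE; by field.
  rewrite ler_pdivrMr// mul1r -[1]/(1%:~R) -rmorphN -rmorphB /= ler_int; lia.
- have : (b%:~R - a%:~R * k%:R) / (1 - a%:~R) <= 1 :> K.
    apply: (lattice_scale_le1 Le e0).
    have := polar_conv Pq Pvk (ltW ci0) ac0; rewrite sum1 => /(_ (lexx _)).
    congr P; rewrite qE; apply/rowP => i; rewrite !mxE; by field.
  rewrite ler_pdivrMr// mul1r -[1]/(1%:~R) -[k%:R]/((k%:Z)%:~R).
  by rewrite -rmorphM -!rmorphB /= ler_int; lia.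
Qed.

Lemma polar_segment v e (a b c : K) : P (v + a *: e) -> P (v + c *: e) ->
  a <= b -> b <= c -> P (v + b *: e).
Proof.
move=> Pa Pc ab bc u Uu; have := Pa u Uu; have := Pc u Uu.
rewrite !dotD !dotZ => Pcu Pau.
by have [ue|ue] := lerP 0 (dot u e); nra.
Qed.

(** As [v - e] is outside, [v] is an end of the edge. The count is 4 + 5 for an edge of length 3 and
    5 + 3 for one of length 4. *)
Lemma card_long_edge u v e : U u -> L v -> dot u v = 1 -> P v ->
  L e -> e != 0 -> dot u e = 0 ->
  (forall x, L x -> exists a b : int, x = a%:~R *: v + b%:~R *: e) ->
  ~ P (v + (-1) *: e) -> P (v + 3%:R *: e) ->
  ([set x | [/\ L x, P x & x != 0]] #<= `I_9)%card.
Proof.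
move=> Uu Lv uv Pv Le e0 ue veP Pleft P3.
have [k [k34 Pk Pk1]] : exists k, [/\ k = 3%N \/ k = 4%N, P (v + k%:R *: e) &
    ~ P (v + k.+1%:R *: e)].
  have [P4|?] := pselect (P (v + 4%:R *: e)); last by exists 3%N; split; [left| |].
  (* With length 5, a lattice point in a row [a < 0] would need [a - 1 <= b <= 1 + 4 a], which is
     impossible. *)
  exists 4%N; split => //; [by right|] => P5.
  have [q [Lq Pq uq]] := U_neg Uu; have [a [b qE]] := veP q Lq.
  have a0 : a < 0.
    by move: uq; rewrite qE dotD !dotZ uv ue mulr1 mulr0 addr0 ltrz0.
  by have := row_bound Le e0 Pv P5 Pq qE (ltW a0); lia.
(* The pairs [(a, b)] that [row_bound] allows, without the origin: the edge in row 1, then rows 0,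
   -1 and, for [k = 3], -2. *)
pose s : seq (int * int) := if k == 3%N
  then [:: (1, 0); (1, 1); (1, 2); (1, 3); (0, 1); (0, -1); (-1, -1); (-1, -2);
           (-2, -3)]
  else [:: (1, 0); (1, 1); (1, 2); (1, 3); (1, 4); (0, 1); (0, -1); (-1, -2)].
apply: (@card_le_trans _ _ _ `I_(size s)); last first.
  by rewrite card_le_II /s; case: k34 => ->.
rewrite -(size_map (fun p => p.1%:~R *: v + p.2%:~R *: e)).
apply: card_le_seq => x [Lx Px x0]; have [a [b xE]] := veP x Lx.
apply/mapP; exists (a, b) => //=.
have a1 : a <= 1.
  by have := Px u Uu; rewrite xE dotD !dotZ uv ue mulr1 mulr0 addr0 lerz1.
have [aE|aN1] := eqVneq a 1; last first.
  have a0 : a <= 0 by lia.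
  have := row_bound Le e0 Pv Pk Px xE a0.
  have : a != 0 \/ b != 0.
    have [a00|] := eqVneq a 0; last by left.
    right; apply: contra_neq x0 => b00.
    by rewrite xE a00 b00 !scale0r addr0.
  rewrite /s; case: k34 => -> /= ab0 bnd.
    have : a = 0 /\ b = 1 \/ a = 0 /\ b = -1 \/
      a = -1 /\ (b = -1 \/ b = -2) \/ a = -2 /\ b = -3 by lia.
    by move=> [[-> ->]|[[-> ->]|[[-> [->|->]]|[-> ->]]]].
  have : a = 0 /\ b = 1 \/ a = 0 /\ b = -1 \/ a = -1 /\ b = -2 by lia.
  by move=> [[-> ->]|[[-> ->]|[-> ->]]].
have bk : (0 <= b) && (b <= k%:Z).
  move: Px; rewrite xE aE scale1r => Px; apply/andP; split.
    rewrite leNgt; apply/negP => b0; apply: Pleft.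
    apply: (polar_segment Px P3); last by lra.
    by rewrite -[-1]/((-1)%:~R) ler_int; lia.
  rewrite leNgt; apply/negP => bk; apply: Pk1.
  apply: (polar_segment Pk Px); first by rewrite ler_nat.
  by rewrite -[_.+1%:R]/((Posz k.+1)%:~R) ler_int; lia.
rewrite aE /s; case: k34 bk => -> /= bk.
  have : b = 0 \/ b = 1 \/ b = 2 \/ b = 3 by lia.
  by move=> [->|[->|[->|->]]].
have : b = 0 \/ b = 1 \/ b = 2 \/ b = 3 \/ b = 4 by lia.
by move=> [->|[->|[->|[->|->]]]].
Qed.

(** Reduction to [card_long_edge]: [z] is replaced by the generator [e] of which it is a positive
    multiple, and [x] by the end of the edge in direction [- e]. *)
Lemma card_edge_triple u x z : U u -> L x -> P x -> dot u x = 1 ->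
  L z -> z != 0 -> dot u z = 0 -> P (x + 3%:R *: z) ->
  ([set x | [/\ L x, P x & x != 0]] #<= `I_9)%card.
Proof.
move=> Uu Lx Px ux Lz z0 uz Px3.
have [e0 [Le0 ue0 xe0P]] := facet_frame Uu Lx ux.
have [c [m zE]] := xe0P z Lz.
have c0 : c = 0.
  move: uz; rewrite zE dotD !dotZ ux ue0 mulr1 mulr0 addr0.
  by move=> /eqP; rewrite intr_eq0 => /eqP.
have zE' : z = m%:~R *: e0 by rewrite zE c0 scale0r add0r.
have m0 : m != 0 by apply: contra_neq z0 => m0; rewrite zE' m0 scale0r.
have [e [k [Le ue k0 zk xeP]]] : exists e (k : nat), [/\ L e, dot u e = 0,
    (0 < k)%N, z = k%:R *: e & forall y, L y ->
    exists a b : int, y = a%:~R *: x + b%:~R *: e].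
  case: (intP m) m0 zE' => // k _ zE'; first by exists e0, k.+1; split.
  exists (- e0), k.+1; split => //.
  - have := L_comb (-1) 0 Le0 Le0; congr L.
    by apply/rowP => i; rewrite !mxE; ring.
  - by move: ue0; rewrite /dot !mxE; lra.
  - by rewrite zE'; apply/rowP => i; rewrite !mxE; ring.
  - move=> y /xe0P[a [b ->]]; exists a, (- b).
    by apply/rowP => i; rewrite !mxE; ring.
have e_neq0 : e != 0 by apply: contra_neq z0 => e_0; rewrite zk e_0 scaler0.
have P3 : P (x + 3%:R *: e).
  apply: (@polar_segment x e 0 _ (3 * k)%:R); rewrite ?scale0r ?addr0 ?ler0n//.
    by move: Px3; rewrite zk scalerA natrM.
  by rewrite ler_nat leq_pmulr.
have [n Pn Pn1] : exists2 n : nat, P (x + (- n%:R) *: e) &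
    ~ P (x + (- n.+1%:R) *: e).
  apply: contrapT => Nn; have Pn n : P (x + (- n%:R) *: e).
    elim: n => [|n IHn]; first by rewrite oppr0 scale0r addr0.
    by apply: contrapT => nPn; apply: Nn; exists n.
  (* Each step by [- e] raises [u'] by at least 1, so from its value [a] at [x] it exceeds 1 after
     [|1 - a| + 1] steps. *)
  have [|u' Uu'] := @U_pos (- e); first by rewrite oppr_eq0.
  have [a u'x] := U_int Uu' Lx.
  have [b u'e] := U_int Uu' Le.
  rewrite -scaleN1r dotZ u'e mulN1r oppr_gt0 ltrz0 => b0.
  have := Pn (`|1 - a| + 1)%N u' Uu'; rewrite dotD dotZ u'x u'e.
  rewrite -[_%:R]/((Posz (`|1 - a| + 1))%:~R) -rmorphN -rmorphM -rmorphD /= lerz1; nia.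
have shift (t : K) : x + (- n%:R) *: e + t *: e = x + (t - n%:R) *: e.
  by apply/rowP => i; rewrite !mxE; ring.
apply: (@card_long_edge u (x + (- n%:R) *: e) e) => //.
- have := L_comb 1 (- n%:Z) Lx Le; congr L.
  by apply/rowP => i; rewrite !mxE; ring.
- by rewrite dotD dotZ ux ue mulr0 addr0.
- move=> y /xeP[a [b ->]]; exists a, (b + a * n%:Z).
  by apply/rowP => i; rewrite !mxE; ring.
- by rewrite shift (_ : -1 - n%:R = - n.+1%:R)// -natr1; ring.
- rewrite shift; apply: (polar_segment Pn P3); have := ler0n K n; lra.
Qed.

Lemma card_boundary_le9 : ([set x | [/\ L x, P x & x != 0]] #<= `I_9)%card.
Proof.
have [-> | /eqP/set0P[q [Lq Pq q0]]] := pselect ([set x | [/\ L x, P x & x != 0]] = set0).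
  exact: card_ge0.
have [u0 Uu0 _] := facet_of_lattice_point Lq Pq q0.
have [rho rhoP] := @residue_classes u0 3 Uu0 isT.
have [inj|/existsNP[x /existsNP[y]]] := pselect (forall x y,
    [set x | [/\ L x, P x & x != 0]] x -> [set x | [/\ L x, P x & x != 0]] y ->
    rho x = rho y -> x = y).
  apply: (@card_le_inj _ _ rho) => // x [Lx _ _].
  by have [] := rhoP x Lx.
move=> /not_implyP[[Lx Px x0]] /not_implyP[[Ly Py y0]] /not_implyP[rxy xy].
have [_ _ /(_ y Ly (esym _))] := rhoP x Lx => /(_ (esym rxy))[z Lz xyz].
have xE : x = y + 3%:R *: z by rewrite -xyz addrC subrK.
have z0 : z != 0 by apply/eqP => z0; apply: xy; rewrite xE z0 scaler0 addr0.
have wE : y + z = (1/3%:R) *: x + (2%:R/3%:R) *: y.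
  by rewrite xE; apply/rowP => i; rewrite !mxE; by field.
have Lw : L (y + z).
  by have := L_comb 1 1 Ly Lz; rewrite !scale1r.
(* If [y + z = 0] then [x = - 2 y], and a normal with value 1 at [x] would give [2 a = -1].
   Otherwise [y + z] is a nonzero lattice point inside the segment from [y] to [x], so its ends
   share a facet. *)
have [w0|w0] := eqVneq (y + z) 0.
  have [u Uu uy] := facet_of_lattice_point Lx Px x0.
  have [a ua] := U_int Uu Ly.
  have : dot u (y + z) = 0 by rewrite w0 /dot !mxE; ring.
  move: uy ua; rewrite xE !dotD dotZ => uy ua uz; exfalso.
  have : 2%:R * a%:~R = - 1 :> K by lra.
  rewrite -[2%:R]/(2%:~R) -[- 1]/((-1)%:~R) -rmorphM /= => /intr_inj; lia.
have [|||u Uu [ux uy]] := common_facet Lw w0 Px Py _ _ _ wE; [lra|lra|lra|].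
apply: (@card_edge_triple u y z) => //; last by rewrite -xE.
by move: ux; rewrite xE dotD dotZ; lra.
Qed.

(** * Vertices and their classes modulo 2 *)

Definition exposed (A : set 'rV[K]_2) (w : 'rV[K]_2) : Prop :=
  exists f, forall x, A x -> x != w -> dot f x < dot f w.

(** Otherwise the maximum [dot f q] would be an average of three strictly smaller values. *)
Lemma exposed_barycenter x y z q (a b c : K) : P x -> P y -> P z ->
  exposed P q -> 0 <= a -> 0 <= b -> 0 <= c -> a + b + c = 1 ->
  q = a *: x + b *: y + c *: z -> [\/ q = x, q = y | q = z].
Proof.
move=> Px Py Pz [f fq] a0 b0 c0 abc qE.
have [->|/eqP xq] := pselect (q = x); first by constructor 1.
have [->|/eqP yq] := pselect (q = y); first by constructor 2.
have [->|/eqP zq] := pselect (q = z); first by constructor 3.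
have fx := fq x Px; have fy := fq y Py; have fz := fq z Pz.
rewrite eq_sym in xq; rewrite eq_sym in yq; rewrite eq_sym in zq.
move: fx fy fz => /(_ xq) fx /(_ yq) fy /(_ zq) fz.
have : dot f q = a * dot f x + b * dot f y + c * dot f z.
  by rewrite {1}qE !dotD !dotZ.
have key (t r : K) : 0 <= t -> r < dot f q -> 0 <= t * (dot f q - r) ?= iff (t == 0).
  move=> t0 rq; split; first by rewrite mulr_ge0// subr_ge0 ltW.
  by rewrite eq_sym mulf_eq0 subr_eq0 (gt_eqF rq) orbF.
have := (key _ _ a0 fx).1; have := (key _ _ b0 fy).1; have := (key _ _ c0 fz).1.
have sumq : (a + b + c) * dot f q = dot f q by rewrite abc mul1r.
move=> hc hb ha fqE; exfalso.
have /eqP : 0 = a * (dot f q - dot f x) by lra.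
have /eqP : 0 = b * (dot f q - dot f y) by lra.
have /eqP : 0 = c * (dot f q - dot f z) by lra.
rewrite (key _ _ a0 fx).2 (key _ _ b0 fy).2 (key _ _ c0 fz).2.
by move=> /eqP c_0 /eqP b_0 /eqP a_0; move: abc; rewrite a_0 b_0 c_0; lra.
Qed.

Lemma exposed_between p e (a b c : K) : P (p + a *: e) -> P (p + c *: e) ->
  e != 0 -> a < b -> b < c -> ~ exposed P (p + b *: e).
Proof.
move=> Pa Pc e0 ab bc ex.
have neq (s t : K) : (s == t) = false -> p + s *: e != p + t *: e.
  move=> st; rewrite (inj_eq (addrI p)) -subr_eq0 -scalerBl scaler_eq0.
  by rewrite subr_eq0 negb_or st e0.
case: ex => f fq.
have := fq _ Pa (neq _ _ (lt_eqF ab)).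
have := fq _ Pc (neq _ _ (gt_eqF bc)).
rewrite !dotD !dotZ; nra.
Qed.

Definition corner (w : 'rV[K]_2) : Prop := [/\ L w, P w, w != 0 & exposed P w].

(** The middle one of three points on a line lies strictly between two points of the polygon, so it
    is not exposed. *)
Lemma corners_not_collinear u x y z : U u -> corner x -> corner y -> corner z ->
  dot u x = 1 -> dot u y = 1 -> dot u z = 1 -> x <> y -> x <> z -> y <> z ->
  False.
Proof.
move=> Uu [Lx Px _ Ex] [Ly Py _ Ey] [Lz Pz _ Ez] ux uy uz xy xz yz.
have [e [Le ue xeP]] := facet_frame Uu Lx ux.
have coord w : L w -> dot u w = 1 -> exists b : int, w = x + b%:~R *: e.
  move=> /xeP[a [b ->]]; rewrite dotD !dotZ ux ue mulr1 mulr0 addr0.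
  by move=> ->; exists b; rewrite scale1r.
have [b yE] := coord y Ly uy; have [c zE] := coord z Lz uz.
have xE : x = x + 0%:~R *: e by rewrite scale0r addr0.
have e0 : e != 0 by apply/eqP => e0; apply: xy; rewrite yE e0 scaler0 addr0.
have b0 : b <> 0 by move=> b0; apply: xy; rewrite yE b0 scale0r addr0.
have c0 : c <> 0 by move=> c0; apply: xz; rewrite zE c0 scale0r addr0.
have bc : b <> c by move=> bc; apply: yz; rewrite yE bc.
have mid (i j k : int) : P (x + i%:~R *: e) -> P (x + k%:~R *: e) ->
    exposed P (x + j%:~R *: e) -> i < j -> j < k -> False.
  by move=> Pi Pk Ej ij jk; apply: (exposed_between Pi Pk e0 _ _ Ej); rewrite ltr_int.
rewrite {1}xE in Px; rewrite {1}xE in Ex; rewrite yE in Py Ey; rewrite zE in Pz Ez.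
have : b < 0 /\ 0 < c \/ c < 0 /\ 0 < b \/ 0 < b /\ b < c \/ 0 < c /\ c < b \/
  c < b /\ b < 0 \/ b < c /\ c < 0 by lia.
move=> [|[|[|[|[|]]]]] [h1 h2].
- exact: (mid b 0 c).
- exact: (mid c 0 b).
- exact: (mid 0 b c).
- exact: (mid 0 c b).
- exact: (mid c b 0).
- exact: (mid b c 0).
Qed.

(** The midpoint [x + d] is a lattice point: either it is the origin or [common_facet] applies to
    it. *)
Lemma corner_midpoint x d : corner x -> corner (x + 2%:R *: d) -> L d ->
  x + 2%:R *: d = - x \/
  exists2 u, U u & dot u x = 1 /\ dot u (x + 2%:R *: d) = 1.
Proof.
have h0 : 0 < 1 / 2%:R :> K by lra.
have h1 : 1 / 2%:R + 1 / 2%:R = 1 :> K by lra.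
move=> [Lx Px _ _] [_ Py _ _] Ld; have [xd|xd] := eqVneq (x + d) 0.
  left; apply/rowP => i; move/rowP/(_ i): xd; rewrite !mxE; lra.
right; apply: (@common_facet _ _ (x + d) (1 / 2%:R) (1 / 2%:R)) => //.
- by have := L_comb 1 1 Lx Ld; rewrite !scale1r.
- by apply/rowP => i; rewrite !mxE; field.
Qed.

(** Averaging [q] and [e - e'] with weights [1 / (1 + n)] and [n / (1 + n)] cancels [e'] and leaves
    [(m + n) / (1 + n)] times [e], to which [lattice_scale_le1] applies. *)
Lemma quadrant_bound e e' q (m n : int) : L e -> e != 0 -> P (e - e') ->
  0 <= n -> P q -> q = m%:~R *: e + n%:~R *: e' -> m <= 1.
Proof.
move=> Le e0 Pee' n0 Pq qE.
have n0' : 0 <= n%:~R :> K by rewrite ler0z.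
have n1 : 0 < 1 + n%:~R :> K by rewrite ltr_wpDr.
have n1N : 1 + n%:~R != 0 :> K by rewrite gt_eqF.
have h1 : (1 + n%:~R)^-1 + n%:~R / (1 + n%:~R) <= 1 :> K.
  by rewrite -{1}[(1 + _)^-1]mul1r -mulrDl divff.
have i0 : 0 <= (1 + n%:~R)^-1 :> K by rewrite invr_ge0 ltW.
have Pt := polar_conv Pq Pee' i0 (mulr_ge0 n0' i0) h1.
have : (m%:~R + n%:~R) / (1 + n%:~R) <= 1 :> K.
  apply: (lattice_scale_le1 Le e0); move: Pt; congr P.
  by rewrite qE; apply/rowP => i; rewrite !mxE; field.
by rewrite ler_pdivrMr// mul1r lerD2r lerz1.
Qed.

Lemma card_corners_apex u u' x d d' : U u -> U u' -> L d -> L d' ->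
  corner x -> corner (x + 2%:R *: d) -> corner (x + 2%:R *: d') ->
  d <> 0 -> d' <> 0 -> d <> d' ->
  dot u x = 1 -> dot u (x + 2%:R *: d) = 1 ->
  dot u' x = 1 -> dot u' (x + 2%:R *: d') = 1 ->
  (corner #<= `I_6)%card.
Proof.
move=> Uu Uu' Ld Ld' Cx Cy Cz d0 d'0 dd' ux uy u'x u'z.
have [Lx Px x0 Ex] := Cx; have [Ly Py y0 Ey] := Cy; have [Lz Pz z0 Ez] := Cz.
have h0 : 0 < 1 / 2%:R :> K by lra.
have h1 : 1 / 2%:R + 1 / 2%:R = 1 :> K by lra.
have two0 : 2%:R != 0 :> K by rewrite pnatr_eq0.
have xy : x <> x + 2%:R *: d.
  move=> /eqP; rewrite -subr_eq0 opprD addNKr oppr_eq0 scaler_eq0 (negPf two0) /=.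
  by move/eqP.
have xz : x <> x + 2%:R *: d'.
  move=> /eqP; rewrite -subr_eq0 opprD addNKr oppr_eq0 scaler_eq0 (negPf two0) /=.
  by move/eqP.
have yz : x + 2%:R *: d <> x + 2%:R *: d'.
  by move=> /addrI /(scalerI two0).
have ud : dot u d = 0 by move: uy; rewrite dotD dotZ ux; lra.
have u'd' : dot u' d' = 0 by move: u'z; rewrite dotD dotZ u'x; lra.
have ud' : dot u d' < 0.
  rewrite lt_neqAle; apply/andP; split.
    apply/eqP => ud'; apply: (corners_not_collinear Uu Cx Cy Cz) => //.
    by rewrite dotD dotZ ux ud'; lra.
  by have := Pz u Uu; rewrite dotD dotZ ux; lra.
have u'd : dot u' d < 0.
  rewrite lt_neqAle; apply/andP; split.
    apply/eqP => u'd; apply: (corners_not_collinear Uu' Cx Cy Cz) => //.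
    by rewrite dotD dotZ u'x u'd; lra.
  by have := Py u' Uu'; rewrite dotD dotZ u'x; lra.
have ud'0 : dot u d' != 0 by rewrite lt_eqF.
have u'd0 : dot u' d != 0 by rewrite lt_eqF.
(* The kernel of [u] in [L] is cyclic and contains [d], where [u'] does not vanish. *)
have sep q : L q -> dot u q = 0 -> dot u' q = 0 -> q = 0.
  have [e [Le ue eP]] := U_ker Uu => /eP{}/[apply] -[b ->].
  have [c dE] := eP d Ld ud.
  move: u'd0; rewrite dE !dotZ mulf_eq0 negb_or => /andP[_ u'e] /eqP.
  by rewrite mulf_eq0 (negPf u'e) orbF => /eqP ->; rewrite scale0r.
(* Cramer's rule for the coordinates [u] and [u']: after multiplication by [r * s] the difference of
   the two sides lies in [L], and [sep] kills it. *)
have coord q : L q -> q = x + ((dot u' q - 1) / dot u' d) *: d +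
    ((dot u q - 1) / dot u d') *: d'.
  move=> Lq.
  have [m uq] := U_int Uu Lq; have [m' u'q] := U_int Uu' Lq.
  have [r ud'E] := U_int Uu Ld'; have [s u'dE] := U_int Uu' Ld.
  have Lqx := L_comb 1 (-1) Lq Lx.
  have Ldd := L_comb ((m' - 1) * r) ((m - 1) * s) Ld Ld'.
  have /= Lt := L_comb (r * s) (-1) Lqx Ldd.
  rewrite uq u'q ud'E u'dE in ud'0 u'd0 *.
  have {}t0 : (r%:~R * s%:~R) *: (q - x) =
      ((m' - 1) * r)%:~R *: d + ((m - 1) * s)%:~R *: d'.
    apply/eqP; rewrite -subr_eq0; apply/eqP; rewrite -[RHS](sep _ Lt).
    - by apply/rowP => i; rewrite !mxE; ring.
    - by rewrite !(dotD, dotZ) uq ux ud ud'E; ring.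
    - by rewrite !(dotD, dotZ) u'q u'x u'd' u'dE; ring.
  rewrite -[LHS](subrK x) -[q - x](scalerK (mulf_neq0 ud'0 u'd0)) t0.
  by apply/rowP => i; rewrite !mxE; field; rewrite ud'0.
(* This is the midpoint of the two far ends. If it is nonzero they share a third facet, and
   barycentric coordinates show that the polygon is a triangle. *)
have [w0|w0] := eqVneq (x + d + d') 0; last first.
  have Lw : L (x + d + d').
    have := L_comb 1 1 (L_comb 1 1 Lx Ld) Ld'; congr L.
    by apply/rowP => i; rewrite !mxE; ring.
  have [||||u'' Uu'' [u''y u''z]] :=
    @common_facet _ _ _ (1 / 2%:R) (1 / 2%:R) Lw w0 Py Pz => //.
    by apply/rowP => i; rewrite !mxE; field.
  apply: (@card_le_trans _ _ _ `I_3); last by rewrite card_le_II.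
  apply: (@card_le_seq _ _ [:: x; x + 2%:R *: d; x + 2%:R *: d']).
  move=> q [Lq Pq q0 Eq]; rewrite !inE.
  have u''x : dot u'' x < 1.
    rewrite lt_neqAle Px// andbT; apply/eqP => u''x.
    exact: (corners_not_collinear Uu'' Cx Cy Cz).
  pose b := (dot u' q - 1) / dot u' d / 2%:R.
  pose c := (dot u q - 1) / dot u d' / 2%:R.
  have qE : q = (1 - b - c) *: x + b *: (x + 2%:R *: d) + c *: (x + 2%:R *: d').
    rewrite {1}(coord q Lq); apply/rowP => i; rewrite !mxE /b /c; field.
    by rewrite ud'0 u'd0.
  have b0 : 0 <= b.
    rewrite /b mulr_ge0// ?invr_ge0// mulr_le0// ?subr_le0 ?Pq// invr_le0.
    exact: ltW.
  have c0 : 0 <= c.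
    rewrite /c mulr_ge0// ?invr_ge0// mulr_le0// ?subr_le0 ?Pq// invr_le0.
    exact: ltW.
  have a0 : 0 <= 1 - b - c.
    have := Pq u'' Uu''; rewrite qE !(dotD, dotZ).
    move: u''y u''z; rewrite !(dotD, dotZ) => u''y u''z; nra.
  have sum1 : 1 - b - c + b + c = 1 by ring.
  by case: (exposed_barycenter Px Py Pz Eq a0 b0 c0 sum1 qE) => ->; rewrite eqxx ?orbT.
have xE : x = - d - d'.
  by rewrite -[LHS](addrK (d + d')) addrA w0 sub0r opprD.
have ud'1 : dot u d' = -1.
  by move: ux; rewrite xE /dot !mxE; move: ud; rewrite /dot; lra.
have u'd1 : dot u' d = -1.
  by move: u'x; rewrite xE /dot !mxE; move: u'd'; rewrite /dot; lra.
apply: (@card_le_seq _ _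
  [:: x; x + 2%:R *: d; x + 2%:R *: d'; d; d'; d + d']) => q Cq.
have [Lq Pq q0 Eq] := Cq.
have [uq1|uqN] := eqVneq (dot u q) 1.
  rewrite !inE; have [//|/eqP qx] := eqVneq q x;
    have [//|/eqP qy] := eqVneq q (x + 2%:R *: d).
  by exfalso; apply: (corners_not_collinear Uu Cx Cy Cq) => //; apply/nesym.
have [u'q1|u'qN] := eqVneq (dot u' q) 1.
  rewrite !inE; have [//|/eqP qx] := eqVneq q x;
    have [|/eqP qz] := eqVneq q (x + 2%:R *: d').
    by rewrite !orbT.
  by exfalso; apply: (corners_not_collinear Uu' Cx Cz Cq) => //; apply/nesym.
(* Off both edges the coordinates [- a] and [- b] are nonnegative. They are at most 1 by
   [quadrant_bound], since [x + 2 d = d - d'] and [x + 2 d' = d' - d]; this leaves [d], [d'] and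
   [d + d']. *)
have [b uq] := U_int Uu Lq; have [a u'q] := U_int Uu' Lq.
have qE : q = (- a)%:~R *: d + (- b)%:~R *: d'.
  rewrite {1}(coord q Lq) uq u'q ud'1 u'd1 {1}xE.
  by apply/rowP => i; rewrite !mxE; field.
have b0 : b <= 0.
  apply: int_le1_neq1; first by rewrite -(lerz1 K) -uq Pq.
  by rewrite -(eqr_int K) -uq.
have a0 : a <= 0.
  apply: int_le1_neq1; first by rewrite -(lerz1 K) -u'q Pq.
  by rewrite -(eqr_int K) -u'q.
have a1 : - a <= 1.
  apply: (quadrant_bound Ld _ _ _ Pq qE); rewrite ?oppr_ge0//; first exact/eqP.
  by move: Py; rewrite xE; congr P; apply/rowP => i; rewrite !mxE; ring.
have b1 : - b <= 1.
  rewrite addrC in qE; apply: (quadrant_bound Ld' _ _ _ Pq qE);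
    rewrite ?oppr_ge0//; first exact/eqP.
  by move: Pz; rewrite xE; congr P; apply/rowP => i; rewrite !mxE; ring.
have z1 : (- -1)%:~R = 1 :> K by [].
have z0' : (- 0)%:~R = 0 :> K by [].
move: q0; rewrite qE.
case: (int_in_N1_0 a0 a1) (int_in_N1_0 b0 b1) => aE [] bE;
  rewrite aE bE ?z1 ?z0' ?scale0r ?scale1r ?addr0 ?add0r ?eqxx// => _.
- by rewrite !inE eqxx ?orbT.
- by rewrite !inE eqxx ?orbT.
- by rewrite !inE eqxx ?orbT.
Qed.

Lemma card_corners_le6 : (corner #<= `I_6)%card.
Proof.
have [cor0 | /eqP/set0P[q [Lq Pq q0 _]]] := pselect (corner = set0).
  by rewrite cor0 card_ge0.
have [u0 Uu0 _] := facet_of_lattice_point Lq Pq q0.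
have [rho rhoP] := @residue_classes u0 2 Uu0 isT.
have two0 : 2%:R != 0 :> K by rewrite pnatr_eq0.
have rho_gt0 x : corner x -> (0 < rho x)%N.
  move=> [Lx Px x0 _]; rewrite lt0n; apply/eqP => rx.
  have [_ /(_ rx)[z Lz xE] _] := rhoP x Lx.
  have [u Uu ux] := facet_of_lattice_point Lx Px x0.
  have [a ua] := U_int Uu Lz.
  have /intr_inj : (2 * a)%:~R = 1%:~R :> K by rewrite rmorphM /= -ua -dotZ -xE.
  by move=> /(congr1 absz); rewrite abszM; case: (absz a) => [|[]].
have apex x y z : corner x -> corner y -> corner z -> x <> y -> x <> z -> y <> z ->
    rho x = rho y -> rho x = rho z -> y <> - x -> z <> - x ->
    (corner #<= `I_6)%card.
  move=> Cx Cy Cz xy xz yz rxy rxz yx zx.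
  have [Lx _ _ _] := Cx; have [Ly _ _ _] := Cy; have [Lz _ _ _] := Cz.
  have [_ _ /(_ x Lx (esym rxy))[d Ld yxd]] := rhoP y Ly.
  have [_ _ /(_ x Lx (esym rxz))[d' Ld' zxd]] := rhoP z Lz.
  have yE : y = x + 2%:R *: d by rewrite -yxd addrC subrK.
  have zE : z = x + 2%:R *: d' by rewrite -zxd addrC subrK.
  rewrite yE in Cy xy yz yx; rewrite zE in Cz xz yz zx.
  have [//|[u Uu [ux uy]]] := corner_midpoint Cx Cy Ld.
  have [//|[u' Uu' [u'x u'z]]] := corner_midpoint Cx Cz Ld'.
  apply: (@card_corners_apex u u' x d d') => //.
  - by move=> d0; apply: xy; rewrite d0 scaler0 addr0.
  - by move=> d0; apply: xz; rewrite d0 scaler0 addr0.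
  - by move=> dd; apply: yz; rewrite dd.
have [[x [y [z [Cx Cy Cz [xy xz yz] [rxy rxz]]]]]|N3] := pselect (exists x y z,
    [/\ corner x, corner y, corner z, [/\ x <> y, x <> z & y <> z] &
      rho x = rho y /\ rho x = rho z]).
  have ryz : rho y = rho z by rewrite -rxy.
  (* The apex must be opposite to neither other corner; if two of the three are opposite, the third
     one serves. *)
  have [yx|yx] := pselect (y = - x).
    apply: (apex z x y) => //; try exact/nesym; try exact/esym.
    - by move=> xNz; apply: yz; rewrite yx xNz opprK.
    - by move=> yNz; apply: xz; apply: oppr_inj; rewrite -yx yNz.
  have [zx|zx] := pselect (z = - x).
    apply: (apex y x z) => //; try exact/nesym.
    - by move=> xNy; apply: yx; rewrite xNy opprK.
    - by move=> zNy; apply: xy; apply: oppr_inj; rewrite -zx zNy.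
  exact: (apex x y z).
(* A chosen corner of class [c], with 0 as default for an empty class. At most two corners share a
   class, so being the chosen one or not tells them apart. *)
pose r c := xget 0 [set x | corner x /\ rho x = c].
apply: (@card_le_inj _ _ (fun x => (rho x).-1 * 2 + (x != r (rho x)))%N).
  move=> x Cx; have [Lx _ _ _] := Cx; have [rx _ _] := rhoP x Lx.
  by have := rho_gt0 x Cx; case: (x != _); lia.
move=> x y Cx Cy fxy; apply: contrapT => xy; apply: N3.
have rxy : rho x = rho y.
  have := rho_gt0 x Cx; have := rho_gt0 y Cy.
  by move: fxy; case: (x != _); case: (y != _); lia.
have bxy : (x != r (rho x)) = (y != r (rho x)).
  by move: fxy; rewrite rxy => /addnI; case: (x != _); case: (y != _).
have [Cr rr] : corner (r (rho x)) /\ rho (r (rho x)) = rho x.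
  by apply: (@xgetPex _ 0 [set x0 | corner x0 /\ rho x0 = rho x]); exists x.
have [xr|xr] := eqVneq x (r (rho x)).
  by move: bxy; rewrite -xr eqxx /= => /esym/negbFE/eqP yx; case: xy.
move: bxy; rewrite xr => /esym yr.
by exists x, y, (r (rho x)); split => //; split => //; exact/eqP.
Qed.
End ReflexivePolygon.

(** * Edges and vertices of a planar polytope *)

Definition cross (K : realFieldType) (x y : 'rV[K]_2) : K :=
  x 0 0 * y 0 1 - x 0 1 * y 0 0.

(** The counterclockwise quarter turn, which turns [cross x] into a functional. *)
Definition perp (K : realFieldType) (x : 'rV[K]_2) : 'rV[K]_2 :=
  \row_i (if i == 0 then - x 0 1 else x 0 0).

Lemma dot_perp (K : realFieldType) (x y : 'rV[K]_2) : dot (perp x) y = cross x y.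
Proof. by rewrite /dot /cross !mxE /=; ring. Qed.

Lemma dotDl (K : realFieldType) (f g x : 'rV[K]_2) :
  dot (f + g) x = dot f x + dot g x.
Proof. by rewrite /dot !mxE; ring. Qed.

Lemma dotZl (K : realFieldType) (g x : 'rV[K]_2) a : dot (a *: g) x = a * dot g x.
Proof. by rewrite /dot !mxE; ring. Qed.

Lemma plane_rowP (K : realFieldType) (x y : 'rV[K]_2) :
  x 0 0 = y 0 0 -> x 0 1 = y 0 1 -> x = y.
Proof.
move=> h0 h1; apply/rowP => -[[|[|//]] i].
- by rewrite (_ : Ordinal i = 0)//; exact/val_inj.
- by rewrite (_ : Ordinal i = 1)//; exact/val_inj.
Qed.

Lemma plane_basis (K : realFieldType) (v w x : 'rV[K]_2) : cross v w != 0 ->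
  x = (cross x w / cross v w) *: v + (cross v x / cross v w) *: w.
Proof.
by rewrite /cross => vw; apply: plane_rowP; rewrite !mxE; field; rewrite vw.
Qed.

Lemma line_param (K : realFieldType) (g y w x : 'rV[K]_2) : cross y w != 0 ->
  dot g y = 1 -> dot g w = 1 -> dot g x = 1 ->
  exists t, x = w + t *: (w - y).
Proof.
move=> yw gy gw gx; have xE := plane_basis x yw.
set a := cross x w / _ in xE; set b := cross y x / _ in xE.
have ab : a + b = 1 by move: gx; rewrite xE dotD !dotZ gy gw !mulr1.
exists (- a); rewrite {1}xE.
by apply/rowP => i; rewrite !mxE (_ : b = 1 - a); [ring|rewrite -ab addrC addKr].
Qed.

Lemma dot_self_gt0 (K : realFieldType) (y : 'rV[K]_2) : y != 0 -> 0 < dot y y.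
Proof.
move=> y0; have : y 0 0 != 0 \/ y 0 1 != 0.
  have [a|a] := eqVneq (y 0 0) 0; last by left.
  by right; apply: contra_neq y0 => b; apply: plane_rowP; rewrite mxE.
rewrite /dot -!expr2 => -[h|h].
- by rewrite ltr_pwDl ?exprn_even_gt0 ?sqr_ge0.
- by rewrite ltr_pwDr ?exprn_even_gt0 ?sqr_ge0.
Qed.

Lemma seq_argmin (K : realFieldType) (T : eqType) (F : T -> K) (p : pred T)
    (s : seq T) : has p s ->
  exists x, [/\ x \in s, p x & forall y, y \in s -> p y -> F x <= F y].
Proof.
elim: s => // a s IHs; have [hs _|/hasPn Ns] := boolP (has p s).
  have [x [xs px xmin]] := IHs hs.
  have [pa|Npa] := boolP (p a); last first.
    exists x; split => // [|y]; first by rewrite inE xs orbT.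
    rewrite inE => /predU1P[->|]; [by rewrite (negPf Npa)|exact: xmin].
  have [ax|xa] := leP (F a) (F x).
    exists a; split => // [|y]; first by rewrite inE eqxx.
    rewrite inE => /predU1P[->//|ys py].
    exact: le_trans ax (xmin _ ys py).
  exists x; split => // [|y]; first by rewrite inE xs orbT.
  by rewrite inE => /predU1P[->|]; [rewrite ltW|exact: xmin].
move=> /= /orP[pa|/hasP[y /Ns/negPf->//]].
exists a; split => // [|y]; first by rewrite inE eqxx.
by rewrite inE => /predU1P[->//|/Ns/negPf->].
Qed.

(* Among finitely many points, the successor map turns counterclockwise by less
   than a half turn, so its orbits sweep out the whole plane: the points on one
   side of [y] cannot all have their successor on the same side, because the
   cotangent [dot y v / cross v y] strictly increases along successors. *)
Lemma cones_cover (K : realFieldType) (s : seq 'rV[K]_2) (S : set 'rV[K]_2)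
    (R : 'rV[K]_2 -> 'rV[K]_2 -> Prop) :
  S `<=` [set` s] -> S !=set0 ->
  (forall v, S v -> exists2 w, S w & R v w /\ 0 < cross v w) ->
  forall y, y != 0 -> exists v w, [/\ S v, S w, R v w &
    [/\ 0 < cross v w, 0 <= cross v y & 0 <= cross y w]].
Proof.
move=> Ss [v0 Sv0] next y y0.
have yy := dot_self_gt0 y0.
have cot v w : dot y w * cross v y - dot y v * cross w y = dot y y * cross v w.
  by rewrite /dot /cross; ring.
(* The point of greatest cotangent on one side of [y] has its successor off that side. *)
have last_on_side (e : K) : (exists2 v, S v & 0 < e * cross v y) ->
    exists v w, [/\ S v, S w, R v w, 0 < cross v w &
      0 < e * cross v y /\ e * cross w y <= 0].
  move=> [v1 Sv1 v1y].
  have [|v [vs /andP[/asboolP Sv vy] vmin]] := @seq_argmin K _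
      (fun v => - (dot y v / cross v y))
      (fun v => `[< S v >] && (0 < e * cross v y)) s.
    by apply/hasP; exists v1; [exact: Ss|apply/andP; split => //; exact/asboolP].
  have [w Sw [Rvw vw]] := next v Sv.
  exists v, w; split => //; split => //; rewrite leNgt; apply/negP => wy.
  have := vmin w (Ss _ Sw); rewrite wy andbT => /(_ (asboolT Sw)).
  have vy0 : cross v y != 0 by apply: contraTneq vy => ->; rewrite mulr0 ltxx.
  have wy0 : cross w y != 0 by apply: contraTneq wy => ->; rewrite mulr0 ltxx.
  have vwy : 0 < cross v y * cross w y.
    have := mulr_gt0 vy wy; rewrite mulrACA pmulr_rgt0// -expr2.
    rewrite lt_neqAle sqr_ge0 andbT eq_sym sqrf_eq0.
    by apply: contraTneq vy => ->; rewrite mul0r ltxx.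
  rewrite lerN2 leNgt => /negP; apply.
  rewrite -subr_gt0 (_ : _ - _ = (dot y y * cross v w) / (cross v y * cross w y)).
    by rewrite divr_gt0// mulr_gt0.
  by rewrite -cot; field; rewrite vy0 wy0.
have [pos|] := pselect (exists2 v, S v & 0 < 1 * cross v y).
  have [v [w [Sv Sw Rvw vw]]] := last_on_side 1 pos; rewrite !mul1r => -[vy wy].
  exists v, w; split => //; split=> //; first exact: ltW.
  by move: wy; rewrite /cross; lra.
move=> npos; have nonpos v : S v -> cross v y <= 0.
  move=> Sv; rewrite leNgt; apply/negP => vy; apply: npos.
  by exists v; rewrite ?mul1r.
exfalso.
(* With no point on the positive side, the last one on the negative side has its successor [w] on
   the line of [y], and the successor of [w] is then on the positive side. If all points are on that
   line, [cot] makes [cross v0 w] vanish. *)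
have [neg|nneg] := pselect (exists2 v, S v & 0 < -1 * cross v y).
  have [v [w [Sv Sw Rvw vw [vy wy]]]] := last_on_side (-1) neg.
  have [w' Sw' [_ ww']] := next w Sw.
  have wy0 : cross w y = 0 by have := nonpos w Sw; lra.
  have : cross v w * cross w' y = - cross v y * cross w w' + cross v w' * cross w y.
    by rewrite /cross; ring.
  by rewrite wy0 mulr0 addr0; have := nonpos w' Sw'; nra.
have zero v : S v -> cross v y = 0.
  move=> Sv; have := nonpos v Sv; rewrite le_eqVlt => /predU1P[//|vy].
  by exfalso; apply: nneg; exists v => //; lra.
have [w Sw [_ vw]] := next v0 Sv0.
by have := cot v0 w; rewrite !zero// !mulr0 subr0; nra.
Qed.

(** * Functionals on the plane, interiors and closures *)

Section Functionals.
Variable K : realFieldType.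

Lemma Hom_dot (u : 'Hom('rV[K]_2, K^o)) : exists g, forall x, u x = dot g x :> K.
Proof.
exists (\row_i u (delta_mx 0 i)) => x.
have {1}-> : x = x 0 0 *: delta_mx 0 0 + x 0 1 *: delta_mx 0 1.
  by apply: plane_rowP; rewrite !mxE /=; ring.
by rewrite linearD !linearZ /dot !mxE /= mulrC [X in _ + X]mulrC.
Qed.

Lemma dot_is_linear (g : 'rV[K]_2) : linear (dot g : 'rV[K]_2 -> K^o).
Proof. by move=> a x y; rewrite dotD dotZ. Qed.

Lemma dot_Hom (g : 'rV[K]_2) : exists u : 'Hom('rV[K]_2, K^o),
  forall x, u x = dot g x :> K.
Proof.
pose h : {linear 'rV[K]_2 -> K^o} :=
  HB.pack (dot g : 'rV[K]_2 -> K^o)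
    (GRing.isLinear.Build K 'rV[K]_2 K^o *:%R _ (dot_is_linear g)).
by exists (linfun h) => x; rewrite lfunE.
Qed.

Lemma interior_box (A : set 'rV[K]_2) (x : 'rV[K]_2) : A° x ->
  exists2 e : K, 0 < e &
    forall z : 'rV[K]_2, `|x 0 0 - z 0 0| < e -> `|x 0 1 - z 0 1| < e -> A z.
Proof.
move=> /nbhs_ballP[e /= e0 xe]; exists e => // z z0 z1; apply: xe; split => // i j.
rewrite (ord1 i) /ball /=.
by case: j => -[|[|//]] j /=; [move: z0|move: z1]; congr (`| _ - _ | < _);
  congr (_ _ _); exact/val_inj.
Qed.

Lemma box_interior (A : set 'rV[K]_2) (x : 'rV[K]_2) (e : K) : 0 < e ->
  (forall z : 'rV[K]_2, `|x 0 0 - z 0 0| < e -> `|x 0 1 - z 0 1| < e -> A z) -> A° x.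
Proof.
move=> e0 xe; apply/nbhs_ballP; exists e => //= z xz; apply: xe.
- exact: (xz.2 0 0).
- exact: (xz.2 0 1).
Qed.

Lemma dot_continuous (g : 'rV[K]_2) : continuous (dot g : 'rV[K]_2 -> K).
Proof.
move=> x; rewrite /continuous_at /dot.
have c i : (fun y : 'rV[K]_2 => g 0 i * y 0 i) @ x --> g 0 i * x 0 i.
  apply: (@cvgM _ _ (nbhs x) _ (fun _ => g 0 i) (fun y : 'rV[K]_2 => y 0 i)).
    exact: cvg_cst.
  exact: coord_continuous.
exact: (cvgD (c 0) (c 1)).
Qed.

Lemma closure_halfplane (A : set 'rV[K]_2) g (c : K) :
  (forall x, A x -> dot g x <= c) -> forall x, closure A x -> dot g x <= c.
Proof.
move=> Ac x /(@closure_subset _ _ (dot g @^-1` [set t | t <= c])) - /(_ Ac).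
suff cl : closed (dot g @^-1` [set t | t <= c]) by move/cl.
apply: closed_comp => [y _|]; first exact: dot_continuous.
exact: closed_le.
Qed.
End Functionals.

Lemma hull_conv (K : realFieldType) (s : seq 'rV[K]_2) x y (t : K) :
  let P := smallest (@convex_set K 'rV[K]_2) [set` s] in
  P x -> P y -> 0 <= t -> t <= 1 -> P (t *: x + (1 - t) *: y).
Proof.
move=> P Px Py t0 t1 A [Aconv sA].
have Ax := Px A (conj Aconv sA); have Ay := Py A (conj Aconv sA).
have t01 : (0 <= t <= 1) by rewrite t0 t1.
have := Aconv x y (Itv01 t0 t1); rewrite !inE => /(_ Ax Ay).
by [].
Qed.

Section Polytope.
Variables (K : realFieldType) (s : seq 'rV[K]_2).
Local Notation P := (smallest (@convex_set K 'rV[K]_2) [set` s]).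
Hypothesis P0 : P° 0.

Lemma hull_gen c : c \in s -> P c.
Proof. by move=> cs A [_]; apply. Qed.

Lemma hull_le f (a : K) : (forall c, c \in s -> dot f c <= a) ->
  forall x, P x -> dot f x <= a.
Proof.
move=> sa x /(_ [set z | dot f z <= a]); apply; split => [y z t|]; last exact: sa.
rewrite !inE /= => ya za; rewrite /conv /= dotD !dotZ.
have t0 : 0 <= t%:num :> K by [].
have t1 : t%:num <= 1 :> K by [].
rewrite /unstable.onem; nra.
Qed.

Lemma hull_absorbing x : exists2 t : K, 0 < t & P (t *: x).
Proof.
have [e e0 eP] := interior_box P0.
pose d := 1 + `|x 0 0| + `|x 0 1|.
have n0 := normr_ge0 (x 0 0); have n1 := normr_ge0 (x 0 1).
have d0 : 0 < d by rewrite /d; lra.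
exists (e / d); first by rewrite divr_gt0.
apply: eP; rewrite !mxE sub0r normrN normrM gtr0_norm ?divr_gt0// mulrAC
  ltr_pdivrMr// ltr_pM2l// /d; lra.
Qed.

(** Since the origin is interior, a positive multiple of [x] is in the hull, where [f] would be
    nonpositive if it were so at all generators. *)
Lemma gen_dot_gt0 f x : 0 < dot f x -> exists2 c, c \in s & 0 < dot f c.
Proof.
move=> fx; have [t t0 Ptx] := hull_absorbing x.
apply: contrapT => Nc; have : dot f (t *: x) <= 0.
  apply: (hull_le _ Ptx) => c cs; rewrite leNgt; apply/negP => fc.
  by apply: Nc; exists c.
by rewrite dotZ pmulr_rle0// leNgt fx.
Qed.

Definition supporting u := forall x, P x -> dot u x <= 1.

(* The edge on [dot u = 1], with endpoint [w] counterclockwise from its point [y]. *)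
Definition edge u y w := [/\ supporting u, w \in s, dot u y = 1, dot u w = 1 &
  0 < cross y w /\ forall c, c \in s -> dot u c = 1 -> cross y c <= cross y w].

(* Rotating the supporting line [dot f = 1] about [y] until it meets the
   generators that lie counterclockwise from [y]. *)
Lemma rotate_to_edge f y : supporting f -> dot f y = 1 ->
  exists u w, edge u y w.
Proof.
move=> fP fy.
have y0 : y != 0.
  by apply/eqP => y0; move: fy; rewrite y0 /dot !mxE; lra.
have [|c cs yc] := @gen_dot_gt0 (perp y) (perp y).
  have := dot_self_gt0 y0; rewrite /dot !mxE /=; lra.
rewrite dot_perp in yc.
(* The parameter at which the rotated functional [f + F c *: perp y] reaches 1 at [c]; its least
   value belongs to the first generator met. *)
pose F c := (1 - dot f c) / cross y c.
have [|b [bs yb bmin]] := @seq_argmin K _ F (fun c => 0 < cross y c) s.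
  by apply/hasP; exists c.
pose u := f + F b *: perp y.
have uE x : dot u x = dot f x + F b * cross y x by rewrite dotDl dotZl dot_perp.
have Fb0 : 0 <= F b.
  apply: divr_ge0; last exact: ltW.
  by rewrite subr_ge0; apply: fP; apply: hull_gen.
have ub : dot u b = 1 by rewrite uE /F divfK ?gt_eqF//; ring.
have yy : cross y y = 0 by rewrite /cross; ring.
have [|w [ws /eqP uw wmax]] := @seq_argmin K _ (fun c => - cross y c)
    (fun c => dot u c == 1) s.
  by apply/hasP; exists b => //; exact/eqP.
exists u, w; split => //.
- apply: hull_le => a sa; rewrite uE.
  have fa : dot f a <= 1 by apply: fP; exact: hull_gen.
  have [ya|ya] := ltP 0 (cross y a); last by nra.
  have := bmin a sa ya; rewrite {2}/F ler_pdivlMr//; lra.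
- by rewrite uE fy yy; ring.
- split => [|a sa ua]; last by rewrite -lerN2 wmax//; exact/eqP.
  by rewrite (lt_le_trans yb)// -lerN2 wmax//; exact/eqP.
Qed.

(** A generator with the largest first coordinate lies on a vertical supporting line, which can be
    rotated about it. *)
Lemma edge_exists : exists u y w, y \in s /\ edge u y w.
Proof.
pose f : 'rV[K]_2 := delta_mx 0 0.
have fE x : dot f x = x 0 0 by rewrite /dot !mxE /=; ring.
have [|c cs fc] := @gen_dot_gt0 f f; first by rewrite fE mxE ltr01.
have [|y [ys _ ymax]] := @seq_argmin K _ (fun c => - dot f c) predT s.
  by apply/hasP; exists c.
have fy : 0 < dot f y by rewrite (lt_le_trans fc)// -lerN2 ymax.
have [||u [w uyw]] := @rotate_to_edge ((dot f y)^-1 *: f) y.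
- move=> x Px; rewrite dotZl mulrC ler_pdivrMr// mul1r.
  by apply: (hull_le _ Px) => a sa; rewrite -lerN2 ymax.
- by rewrite dotZl mulVf// gt_eqF.
by exists u, y, w.
Qed.

(** Rotating about [w] gives a second edge with normal [u'], and [u + u'] reaches its maximum 2 only
    at [w]. *)
Lemma edge_end_vertex u y w : edge u y w -> vertices P w.
Proof.
move=> [uP ws uy uw [yw ymax]]; have yw0 : cross y w != 0 by rewrite gt_eqF.
have [u' [w' [u'P w's u'w u'w' [ww' _]]]] := rotate_to_edge uP uw.
(* Were the two lines equal, [w'] would lie on the first edge beyond its end [w]. *)
have u'y : dot u' y != 1.
  apply/eqP => u'y; have [t w'E] := line_param yw0 u'y u'w u'w'.
  have uw' : dot u w' = 1 by rewrite w'E !(dotD, dotZ) -scaleN1r dotZ uy uw; ring.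
  have := ymax w' w's uw'; move: ww'.
  rewrite w'E; have -> : cross w (w + t *: (w - y)) = t * cross y w.
    by rewrite /cross !mxE; ring.
  have -> : cross y (w + t *: (w - y)) = (1 + t) * cross y w.
    by rewrite /cross !mxE; ring.
  by nra.
have [h hE] := dot_Hom (u + u'); exists h, 2%:R; split.
  by move=> x Px; rewrite hE dotDl; have := uP x Px; have := u'P x Px; lra.
apply/seteqP; split => x /=.
  by move=> ->; split; [exact: hull_gen|rewrite hE dotDl uw u'w; ring].
move=> [Px]; rewrite hE dotDl => x2.
have ux : dot u x = 1 by have := uP x Px; have := u'P x Px; lra.
have u'x : dot u' x = 1 by have := uP x Px; have := u'P x Px; lra.
have [t xE] := line_param yw0 uy uw ux.
move: u'x; rewrite xE !(dotD, dotZ) -scaleN1r dotZ u'w mulN1r.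
move=> /eqP; rewrite -subr_eq0 addrAC subrr add0r mulf_eq0 subr_eq0.
by rewrite [1 == _]eq_sym (negPf u'y) orbF => /eqP ->; rewrite scale0r addr0.
Qed.

Lemma edge_facet u y w : P y -> edge u y w ->
  facet P [set x | P x /\ dot u x = 1].
Proof.
move=> Py [uP ws uy uw [yw _]]; have yw0 : cross y w != 0 by rewrite gt_eqF.
have Pw := hull_gen ws.
split.
  have [h hE] := dot_Hom u; exists h, 1; split=> [x Px|]; first by rewrite hE uP.
  by apply/seteqP; split => x /= []; rewrite hE.
split; first by exists w.
exists <[w - y]>%VS; split.
- rewrite dim_vline (_ : w - y != 0)//; apply/eqP => wy.
  move: yw0; rewrite (_ : cross y w = cross y (w - y)).
    by rewrite wy /cross !mxE !mulr0 subrr eqxx.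
  by rewrite /cross !mxE; ring.
- move=> a b [_ ua] [_ ub].
  have [t ->] := line_param yw0 uy uw ua; have [r ->] := line_param yw0 uy uw ub.
  by rewrite opprD addrACA subrr add0r -scalerBl memvZ// memv_line.
- by move=> W WP; rewrite -memvE; apply: WP.
Qed.
End Polytope.

(** * The sublattice generated by the boundary *)

Lemma gcd_cofactors (a b : int) : a != 0 \/ b != 0 ->
  exists (d : nat) (a' b' p q : int),
    [/\ (0 < d)%N, a = d%:Z * a', b = d%:Z * b' & p * a' + q * b' = 1].
Proof.
move=> ab; have [p [q pq]] := Bezoutz a b.
have d0 : gcdz a b != 0 by rewrite gcdz_eq0 negb_and; case: ab => ->; rewrite ?orbT.
have [a' aE] := dvdzP (dvdz_gcdl a b).
have [b' bE] := dvdzP (dvdz_gcdr a b).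
exists `|gcdz a b|%N, a', b', p, q.
have dE : `|gcdz a b|%:Z = gcdz a b by rewrite gez0_abs.
rewrite absz_gt0 dE; split => //; first by rewrite mulrC.
  by rewrite mulrC.
by apply: (mulIf d0); rewrite mul1r -{2}pq mulrDl -!mulrA -aE -bE.
Qed.

(** The point [x / d] is nonzero and lies on the segment from 0 to [x], so it is [x] itself. *)
Lemma primitive_scale (K : realFieldType) (V : lmodType K) (L : set V) (x : V)
  (d : nat) : primitive L x -> (0 < d)%N -> L (d%:R^-1 *: x) -> d = 1%N.
Proof.
move=> [Lx x0 prim] d0 Ld.
have dN : d%:R != 0 :> K by rewrite pnatr_eq0 -lt0n.
have [|/eqP|/eqP] := prim _ Ld.
- exists d%:R^-1 => //=; rewrite in_itv /= invr_ge0 ler0n /=.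
  by rewrite invf_le1 ?ltr0n// ler1n.
- by rewrite scaler_eq0 invr_eq0 (negPf dN) (negPf x0).
- rewrite -subr_eq0 -{2}[x]scale1r -scalerBl scaler_eq0 (negPf x0) orbF subr_eq0.
  by rewrite invr_eq1 pnatr_eq1 => /eqP.
Qed.

Section Arithmetic.
Variables (K : realFieldType) (N : set 'rV[K]_2) (e0 e1 : 'rV[K]_2).
Hypothesis N_coord : forall x,
  N x <-> exists a b : int, x = a%:~R *: e0 + b%:~R *: e1.

(** Dividing [v] by the gcd of its coordinates stays in [N], so the gcd is 1. *)
Lemma primitive_point v : primitive N v -> exists a b p q : int,
  v = a%:~R *: e0 + b%:~R *: e1 /\ p * a + q * b = 1.
Proof.
move=> prim; have [Nv v0 _] := prim; have [a [b vE]] := (N_coord v).1 Nv.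
have [|d [a' [b' [p [q [d0 aE bE pq]]]]]] := @gcd_cofactors a b.
  have [a0|] := eqVneq a 0; last by left.
  by right; apply: contra_neq v0 => b0; rewrite vE a0 b0 !scale0r addr0.
have dN : d%:R != 0 :> K by rewrite pnatr_eq0 -lt0n.
have /(primitive_scale prim d0) d1 : N (d%:R^-1 *: v).
  apply/N_coord; exists a', b'; rewrite vE aE bE !rmorphM /=.
  by apply/rowP => i; rewrite !mxE; field.
by exists a', b', p, q; split => //; rewrite vE aE bE d1 !mul1r.
Qed.

Lemma primitive_dual (u : 'Hom('rV[K]_2, K^o)) x :
  primitive (dual_lattice N) u -> N x -> u x != 0 -> exists a b p q : int,
  [/\ u e0 = a%:~R, u e1 = b%:~R & p * a + q * b = 1].
Proof.
move=> prim Nx ux0; have [uN _ _] := prim.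
have [a ua] : exists a : int, u e0 = a%:~R.
  by apply: uN; apply/N_coord; exists 1, 0; rewrite scale1r scale0r addr0.
have [b ub] : exists b : int, u e1 = b%:~R.
  by apply: uN; apply/N_coord; exists 0, 1; rewrite scale1r scale0r add0r.
have uE (y z : int) : u (y%:~R *: e0 + z%:~R *: e1) = y%:~R * a%:~R + z%:~R * b%:~R.
  by rewrite linearD !linearZ /= ua ub.
have [|d [a' [b' [p [q [d0 aE bE pq]]]]]] := @gcd_cofactors a b.
  have [a0|] := eqVneq a 0; last by left.
  right; apply: contra_neq ux0 => b0; have [y [z ->]] := (N_coord x).1 Nx.
  by rewrite uE a0 b0 !mulr0 addr0.
have dN : d%:R != 0 :> K by rewrite pnatr_eq0 -lt0n.
have /(primitive_scale prim d0) d1 : dual_lattice N (d%:R^-1 *: u).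
  move=> z /N_coord[y [y' ->]]; exists (y * a' + y' * b').
  rewrite scale_lfunE uE aE bE !(rmorphM, rmorphD) /= -[_ *: _]/(_ * _).
  by field.
by exists a', b', p, q; rewrite ua ub aE bE d1 !mul1r.
Qed.

Variables (l : nat).
Hypothesis l_gt0 : (0 < l)%N.

(* [l u] is a primitive element of the dual lattice. *)
Definition normal_of_index u := exists a b p q : int,
  [/\ l%:R * dot u e0 = a%:~R, l%:R * dot u e1 = b%:~R & p * a + q * b = 1].

(* The points of [N] on which [l u] is divisible by [l] are those on which the
   determinant with [v] is, and this holds for every normal [u] with [dot u v = 1]. *)
Lemma adjacent_normals u u' v x : normal_of_index u -> normal_of_index u' ->
  primitive N v -> dot u v = 1 -> dot u' v = 1 -> N x ->
  (exists z : int, dot u x = z%:~R) -> exists z : int, dot u' x = z%:~R.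
Proof.
move=> [g0 [g1 [p [q [ug0 ug1 pq]]]]] [h0 [h1 [_ [_ [uh0 uh1 _]]]]].
move=> /primitive_point[v0 [v1 [r [t [vE rt]]]]] uv u'v /N_coord[x0 [x1 xE]] [m um].
have lN : l%:R != 0 :> K by rewrite pnatr_eq0 -lt0n.
have val f f0 f1 (y0 y1 : int) : l%:R * dot f e0 = f0%:~R ->
    l%:R * dot f e1 = f1%:~R ->
    l%:R * dot f (y0%:~R *: e0 + y1%:~R *: e1) = (f0 * y0 + f1 * y1)%:~R.
  move=> fE0 fE1; rewrite !(dotD, dotZ) rmorphD !rmorphM /= -fE0 -fE1; ring.
have intl (z : int) : l%:R * z%:~R = (l%:Z * z)%:~R :> K by rewrite rmorphM.
have gv : g0 * v0 + g1 * v1 = l%:Z.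
  by apply: (@intr_inj K); rewrite -(val u)// -vE uv mulr1.
have hv : h0 * v0 + h1 * v1 = l%:Z.
  by apply: (@intr_inj K); rewrite -(val u')// -vE u'v mulr1.
have gx : g0 * x0 + g1 * x1 = l%:Z * m.
  by apply: (@intr_inj K); rewrite -(val u)// -xE um.
(* Both [g0] and [g1] times the determinant of [v] and [x] are multiples of [l]; the Bezout relation
   for [g] yields the quotient. *)
pose c := p * (x1 - m * v1) + q * (m * v0 - x0).
have cE : v0 * x1 - v1 * x0 = l%:Z * c.
  transitivity ((p * g0 + q * g1) * (v0 * x1 - v1 * x0)); first by rewrite pq mul1r.
  transitivity (p * (x1 * (g0 * v0 + g1 * v1) - v1 * (g0 * x0 + g1 * x1)) +
    q * (v0 * (g0 * x0 + g1 * x1) - x0 * (g0 * v0 + g1 * v1))); first by ring.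
  by rewrite gv gx /c; ring.
(* The difference [h - g] vanishes at [v], whose coordinates are coprime, so it is [k] times the
   determinant with [v]. *)
pose k := r * (h1 - g1) - t * (h0 - g0).
have k0 : h0 - g0 = - k * v1.
  transitivity ((r * v0 + t * v1) * (h0 - g0)); first by rewrite rt mul1r.
  have -> : (r * v0 + t * v1) * (h0 - g0) = - k * v1 +
    r * ((h0 * v0 + h1 * v1) - (g0 * v0 + g1 * v1)) by rewrite /k; ring.
  by rewrite gv hv subrr mulr0 addr0.
have k1 : h1 - g1 = k * v0.
  transitivity ((r * v0 + t * v1) * (h1 - g1)); first by rewrite rt mul1r.
  have -> : (r * v0 + t * v1) * (h1 - g1) = k * v0 +
    t * ((h0 * v0 + h1 * v1) - (g0 * v0 + g1 * v1)) by rewrite /k; ring.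
  by rewrite gv hv subrr mulr0 addr0.
exists (m + k * c); apply: (mulfI lN); rewrite xE (val u' h0 h1)// intl.
congr (_%:~R).
have -> : h0 * x0 + h1 * x1 = g0 * x0 + g1 * x1 + (h0 - g0) * x0 + (h1 - g1) * x1.
  by ring.
rewrite k0 k1 gx mulrDr mulrCA -cE; ring.
Qed.

(** With [(g0, g1)] the coprime values of [l u] on the basis, [(- g1, g0)] generates the kernel. *)
Lemma normal_kernel u : normal_of_index u ->
  exists e, [/\ N e, dot u e = 0 &
    forall x, N x -> dot u x = 0 -> exists b : int, x = b%:~R *: e].
Proof.
move=> [g0 [g1 [p [q [ug0 ug1 pq]]]]].
have lN : l%:R != 0 :> K by rewrite pnatr_eq0 -lt0n.
exists ((- g1)%:~R *: e0 + g0%:~R *: e1); split.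
- by apply/N_coord; exists (- g1), g0.
- by apply: (mulfI lN); rewrite !(dotD, dotZ) rmorphN /= -ug0 -ug1; ring.
- move=> x /N_coord[x0 [x1 ->]] /(congr1 (fun t => l%:R * t)).
  rewrite !(dotD, dotZ) mulrDr !(mulrCA l%:R) ug0 ug1 mulr0.
  rewrite -!rmorphM -rmorphD /= => /eqP; rewrite intr_eq0 => /eqP gx.
  exists (p * x1 - q * x0).
  have x0E : x0 = (p * x1 - q * x0) * - g1.
    transitivity ((p * g0 + q * g1) * x0); first by rewrite pq mul1r.
    have -> : (p * g0 + q * g1) * x0 = p * (x0 * g0 + x1 * g1) +
      (p * x1 - q * x0) * - g1 by ring.
    by rewrite gx mulr0 add0r.
  have x1E : x1 = (p * x1 - q * x0) * g0.
    transitivity ((p * g0 + q * g1) * x1); first by rewrite pq mul1r.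
    have -> : (p * g0 + q * g1) * x1 = q * (x0 * g0 + x1 * g1) +
      (p * x1 - q * x0) * g0 by ring.
    by rewrite gx mulr0 add0r.
  by rewrite scalerDr !scalerA -!rmorphM /= -x0E -x1E.
Qed.
End Arithmetic.

(** * Walking around the polygon along normals integral on one sublattice *)

Section Assembly.
Variables (K : realFieldType) (N : set 'rV[K]_2) (e0 e1 : 'rV[K]_2).
Variables (s : seq 'rV[K]_2) (l : nat).
Local Notation P := (smallest (@convex_set K 'rV[K]_2) [set` s]).
Hypothesis N_coord : forall x,
  N x <-> exists a b : int, x = a%:~R *: e0 + b%:~R *: e1.
Hypothesis l_gt0 : (0 < l)%N.
Hypothesis P_reflexive : l_reflexive N l P.

Let P0 : P° 0. Proof. by case: P_reflexive. Qed.

Let vertex_primitive v : vertices P v -> primitive N v.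
Proof. by case: P_reflexive => _ + _; apply. Qed.

(** The primitive outer normal of the facet agrees with [l u] at [y] and [w], which form a basis of
    the plane. *)
Lemma edge_normal u y w : P y -> edge s u y w -> normal_of_index e0 e1 l u.
Proof.
move=> Py uyw; have [uP ws uy uw [yw _]] := uyw.
have lN : l%:R != 0 :> K by rewrite pnatr_eq0 -lt0n.
have Pw := hull_gen ws.
have [_ _ /(_ _ (edge_facet Py uyw))[h [prim _ FE]]] := P_reflexive.
have [g hg] := Hom_dot h.
have gy : dot g y = l%:R.
  have : [set x | P x /\ dot u x = 1] y by [].
  by rewrite FE => -[_]; rewrite hg.
have gw : dot g w = l%:R.
  have : [set x | P x /\ dot u x = 1] w by [].
  by rewrite FE => -[_]; rewrite hg.
have hE x : h x = l%:R * dot u x :> K.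
  rewrite hg (plane_basis x (lt0r_neq0 yw)) !dotD !dotZ gy gw uy uw; ring.
have [Nw _ _] := vertex_primitive (edge_end_vertex P0 uyw).
have [|a [b [p [q [ha hb pq]]]]] := primitive_dual N_coord prim Nw.
  by rewrite hg gw.
by exists a, b, p, q; rewrite -!hE.
Qed.

Section Connected.
Variable u0 : 'rV[K]_2.

(* The facet normals [u], scaled to be [1] on the facet, that take integral values
   on the same points of [N] as [u0]. *)
Definition linked_normal u := [/\ supporting s u, normal_of_index e0 e1 l u,
  exists2 v, vertices P v & dot u v = 1 & forall x, N x ->
  (exists z : int, dot u x = z%:~R) <-> (exists z : int, dot u0 x = z%:~R)].

(** Membership in [s] provides the finiteness that [cones_cover] asks for. *)
Definition linked_vertex w :=
  [/\ vertices P w, w \in s & exists2 u, linked_normal u & dot u w = 1].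

(** Rotating about [v] gives the next edge, and [adjacent_normals] at the primitive point [v] passes
    the link on to its normal. *)
Lemma linked_next v : linked_vertex v -> exists2 w, linked_vertex w &
  (exists2 u, linked_normal u & dot u v = 1 /\ dot u w = 1) /\ 0 < cross v w.
Proof.
move=> [Vv vs [u [uP ul _ uu0] uv]].
have [u' [w uvw]] := rotate_to_edge P0 uP uv.
have [u'P ws u'v u'w [vw _]] := uvw.
have u'l := edge_normal (hull_gen vs) uvw.
have linked' : linked_normal u'.
  split => //; first by exists v.
  move=> x Nx; rewrite -uu0//; have pv := vertex_primitive Vv; split.
    exact: (adjacent_normals N_coord l_gt0 u'l ul pv).
  exact: (adjacent_normals N_coord l_gt0 ul u'l pv).
exists w; last by split => //; exists u'.
by split => //; [exact: edge_end_vertex uvw|exists u'].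
Qed.

Hypothesis linked_inhabited : exists w, linked_vertex w.

(** The cones over the linked edges already fill the plane, so the linked normals suffice to
    describe the whole polygon. *)
Lemma linked_cone y : y != 0 -> exists u v w (a b : K),
  [/\ linked_normal u, linked_vertex v, linked_vertex w,
      dot u v = 1 /\ dot u w = 1 &
      [/\ 0 <= a, 0 <= b, 0 < a + b & y = a *: v + b *: w]].
Proof.
move=> y0; have [|//|v [w [Sv Sw [u Uu [uv uw]] [vw vy yw]]]] :=
    @cones_cover K s linked_vertex
  (fun v w => exists2 u, linked_normal u & dot u v = 1 /\ dot u w = 1)
  _ _ linked_next y y0.
  by move=> w [].
have vw0 : cross v w != 0 by rewrite gt_eqF.
have yE := plane_basis y vw0; have wi : 0 <= (cross v w)^-1 by rewrite invr_ge0 ltW.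
exists u, v, w, (cross y w / cross v w), (cross v y / cross v w).
split=> //; split; rewrite ?mulr_ge0//.
rewrite lt_neqAle addr_ge0 ?mulr_ge0// andbT eq_sym; apply: contra_neq y0 => ab.
have /eqP := ab; rewrite paddr_eq0 ?mulr_ge0// => /andP[/eqP a0 /eqP b0].
by rewrite yE a0 b0 !scale0r addr0.
Qed.

Let hull0 : P 0. Proof. exact: (interior_subset P0). Qed.

Lemma linked_ray y : y != 0 -> exists u, [/\ linked_normal u, 0 < dot u y &
  P ((dot u y)^-1 *: y)].
Proof.
move=> /linked_cone[u [v [w [a [b [Uu [Vv vs _] [Vw ws _] [uv uw] [a0 b0 ab yE]]]]]]].
have uy : dot u y = a + b by rewrite yE dotD !dotZ uv uw; ring.
exists u; rewrite uy; split => //.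
have abN : a + b != 0 by rewrite gt_eqF.
have -> : (a + b)^-1 *: y = (a / (a + b)) *: v + (1 - a / (a + b)) *: w.
  by rewrite yE; apply/rowP => i; rewrite !mxE; field.
apply: hull_conv; rewrite ?divr_ge0 ?(ltW ab)//; try exact: hull_gen.
by rewrite ler_pdivrMr// mul1r lerDl.
Qed.

(** A point with [dot u x <= 1] lies between the origin and the point where its ray meets a linked
    edge. *)
Lemma polar_linked : polar linked_normal = P.
Proof.
apply/seteqP; split => x; last by move=> Px u [uP _ _ _]; exact: uP.
move=> xU; have [->//|x0] := eqVneq x 0.
have [u [Uu ux Pux]] := linked_ray x0.
have uxN : dot u x != 0 by rewrite gt_eqF.
have := hull_conv Pux hull0 (ltW ux) (xU u Uu).
by rewrite scaler0 addr0 scalerA divff// scale1r.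
Qed.

(** The sublattice for which the polygon is 1-reflexive. *)
Definition linked_lattice : set 'rV[K]_2 :=
  [set x | N x /\ exists z : int, dot u0 x = z%:~R].

Lemma linked_lattice_facet u x : linked_normal u -> N x -> dot u x = 1 ->
  linked_lattice x.
Proof.
move=> [_ _ _ uu0] Nx ux; split => //; apply/(uu0 x Nx); by exists 1.
Qed.

(** A point near [t *: x] is [t *: x] plus [1 - t] times a point near the origin, which is in the
    hull. *)
Lemma hull_scaled_interior x (t : K) : 0 <= t -> t < 1 -> P x -> P° (t *: x).
Proof.
move=> t0 t1 Px; have [e e_gt0 eP] := interior_box P0.
have c0 : 0 < 1 - t by rewrite subr_gt0.
have cN : 1 - t != 0 by rewrite gt_eqF.
apply: (@box_interior _ _ _ (e * (1 - t))); first exact: mulr_gt0.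
move=> z z0 z1; have Pz : P ((1 - t)^-1 *: (z - t *: x)).
  apply: eP; rewrite !mxE sub0r normrN normrM gtr0_norm ?invr_gt0// mulrC
    ltr_pdivrMr// distrC; first by move: z0; rewrite !mxE.
  by move: z1; rewrite !mxE.
have := hull_conv Px Pz t0 (ltW t1); congr P.
by rewrite scalerA divff// scale1r addrC subrK.
Qed.

(** If [dot u x < 1] for the edge on its ray, [x] is a shrunk point of that edge and hence
    interior. *)
Lemma boundary_linked x : boundary P x -> N x ->
  [/\ linked_lattice x, polar linked_normal x & x != 0].
Proof.
move=> [clPx Nint] Nx.
have x0 : x != 0 by apply/eqP => x0; apply: Nint; rewrite x0.
have xU : polar linked_normal x.
  by move=> u [uP _ _ _]; exact: closure_halfplane uP _ clPx.
have [u [Uu ux Pux]] := linked_ray x0.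
split => //; apply: (linked_lattice_facet Uu Nx); apply/eqP.
rewrite eq_le xU//= leNgt; apply/negP => ux1; apply: Nint.
have := hull_scaled_interior (ltW ux) ux1 Pux.
by rewrite scalerA divff ?scale1r// gt_eqF.
Qed.

Lemma vertex_exposed v : vertices P v ->
  exists f, forall x, P x -> x != v -> dot f x < dot f v.
Proof.
move=> [h [c [hc vE]]]; have [f hf] := Hom_dot h; exists f => x Px xv.
have [Pv hv] : P v /\ h v = c by have : [set v] v by []; rewrite vE.
rewrite -!hf hv lt_neqAle hc// andbT; apply: contra_neq xv => hx.
by have : [set x | P x /\ h x = c] x by []; rewrite -vE.
Qed.

Lemma vertex_linked v : vertices P v ->
  [/\ linked_lattice v, polar linked_normal v, v != 0 &
      exposed (polar linked_normal) v].
Proof.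
move=> Vv; have [Nv v0 _] := vertex_primitive Vv.
have [f fv] := vertex_exposed Vv.
have Pv : P v by case: Vv => h [c [_ vE]]; have : [set v] v by []; rewrite {1}vE => -[].
have [u [Uu uv Puv]] := linked_ray v0.
split => //; rewrite ?polar_linked//; last by exists f.
apply: (linked_lattice_facet Uu Nv); apply/eqP.
have uvN : dot u v != 0 by rewrite gt_eqF.
have uv1 : dot u v <= 1 by case: Uu => uP _ _ _; exact: uP.
rewrite eq_le uv1 leNgt; apply/negP => uv_lt1.
(* If [dot u v < 1], then [v] is strictly between 0 and a point of the edge on its ray, against
   exposedness. *)
have := fv 0 hull0; rewrite eq_sym => /(_ v0).
have := fv _ Puv; rewrite dotZ => /(_ _)/wrap[].
  apply/eqP => /(congr1 (dot u)); rewrite dotZ mulVf// => e1v.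
  by move: uv_lt1; rewrite -e1v ltxx.
have -> : dot f 0 = 0 by rewrite /dot !mxE; ring.
move=> h fv0; move: h; rewrite mulrC ltr_pdivrMr//; nra.
Qed.

Lemma linked_comb (a b : int) x y : linked_lattice x -> linked_lattice y ->
  linked_lattice (a%:~R *: x + b%:~R *: y).
Proof.
move=> [/N_coord[x0 [x1 xE]] [z xz]] [/N_coord[y0 [y1 yE]] [t yt]]; split.
  apply/N_coord; exists (a * x0 + b * y0), (a * x1 + b * y1).
  by rewrite xE yE; apply/rowP => i; rewrite !mxE; ring.
by exists (a * z + b * t); rewrite dotD !dotZ xz yt; ring.
Qed.

Lemma linked_int u x : linked_normal u -> linked_lattice x ->
  exists z : int, dot u x = z%:~R.
Proof. by move=> [_ _ _ uu0] [Nx u0x]; apply/(uu0 x Nx). Qed.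

Lemma linked_ker u : linked_normal u -> exists e, [/\ linked_lattice e,
  dot u e = 0 & forall x, linked_lattice x -> dot u x = 0 ->
    exists b : int, x = b%:~R *: e].
Proof.
move=> [uP ul uv uu0]; have [e [Ne ue eP]] := normal_kernel N_coord l_gt0 ul.
exists e; split => // [|x [Nx _]]; last exact: eP.
by split => //; apply/(uu0 e Ne); exists 0.
Qed.

Lemma linked_pos x : x != 0 -> exists2 u, linked_normal u & 0 < dot u x.
Proof. by move=> /linked_ray[u [Uu ux _]]; exists u. Qed.

Lemma linked_one u : linked_normal u -> exists2 v, linked_lattice v & dot u v = 1.
Proof.
move=> Uu; have [_ _ [v Vv uv] _] := Uu; exists v => //.
by apply: (linked_lattice_facet Uu) uv; have [] := vertex_primitive Vv.
Qed.

(** For a vertex [x] on the facet, [- x] lies in the cone of two linked vertices; [u] is negative at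
    [- x], so at one of them. *)
Lemma linked_neg u : linked_normal u -> exists q,
  [/\ linked_lattice q, polar linked_normal q & dot u q < 0].
Proof.
move=> Uu; have [_ _ [x Vx ux] _] := Uu; have [_ x0 _] := vertex_primitive Vx.
have [|u' [v [w [a [b [_ [Vv _ _] [Vw _ _] _ [a0 b0 _ xE]]]]]]] := @linked_cone (- x).
  by rewrite oppr_eq0.
have [Lv Uv _ _] := vertex_linked Vv; have [Lw Uw _ _] := vertex_linked Vw.
have [uv|uv] := ltP (dot u v) 0; first by exists v.
exists w; split => //; rewrite ltNge; apply/negP => uw.
have : dot u (- x) = a * dot u v + b * dot u w by rewrite xE dotD !dotZ.
rewrite -scaleN1r dotZ ux; nra.
Qed.

Lemma card_boundary_linked : (boundary P `&` N #<= `I_9)%card.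
Proof.
apply: card_le_trans (card_boundary_le9 linked_comb linked_int linked_ker
  linked_pos linked_one linked_neg).
by apply: subset_card_le => x [bx Nx]; exact: boundary_linked.
Qed.

Lemma card_vertices_linked : (vertices P #<= `I_6)%card.
Proof.
apply: card_le_trans (card_corners_le6 linked_comb linked_int linked_ker
  linked_pos linked_one).
by apply: subset_card_le => v; exact: vertex_linked.
Qed.
End Connected.

Lemma linked_inhabited_ex : exists u w, linked_vertex u w.
Proof.
have [u [y [w [ys uyw]]]] := edge_exists P0.
have Vw := edge_end_vertex P0 uyw; have [uP ws uy uw _] := uyw.
exists u, w; split => //; exists u => //; split => //; last by exists w.
exact: edge_normal (hull_gen ys) uyw.
Qed.

Lemma card_l_reflexive :
  (boundary P `&` N #<= `I_9)%card /\ (vertices P #<= `I_6)%card.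
Proof.
have [u uw] := linked_inhabited_ex.
by split; [exact: card_boundary_linked uw|exact: card_vertices_linked uw].
Qed.
End Assembly.

Lemma lattice_coords (K : realFieldType) (N : set 'rV[K]_2) : lattice N ->
  exists e0 e1, forall x, N x <-> exists a b : int, x = a%:~R *: e0 + b%:~R *: e1.
Proof.
move=> [B _ ->]; exists (row 0 B), (row 1 B).
have zB (z : 'rV[int]_2) : map_mx intr z *m B =
    (z 0 0)%:~R *: row 0 B + (z 0 1)%:~R *: row 1 B.
  apply/rowP => j; rewrite !mxE big_ord_recl big_ord1 !mxE.
  by have -> : lift ord0 ord0 = 1 :> 'I_2 by exact/val_inj.
move=> x; split => [[z _ <-]|[a [b ->]]].
  by exists (z 0 0), (z 0 1); exact: zB.
exists (\row_j (if j == 0 then a else b)) => //.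
by rewrite zB !mxE.
Qed.

Theorem corollary1p7 (l : nat) (N P : set 'rV[rat]_2)
    (l_gt0 : (0 < l)%N) (N_lattice : lattice N)
    (P_polygon : polygon N P) (P_reflexive : l_reflexive N l P) :
  (boundary P `&` N #<= `I_9) /\ (vertices P #<= `I_6).
Proof.
have [[s PE] _ _] := P_polygon; have [e0 [e1 N_coord]] := lattice_coords N_lattice.
rewrite PE in P_reflexive *.
exact: card_l_reflexive N_coord l_gt0 P_reflexive.
Qed.
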